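(* Let $k\geq 2$ be an integer and put $n=k+1$. Then $$\gcd_{2\leq q\leq k+1}\binom{qk}{k}=1 \quad\Longleftrightarrow\quad \frac{n}{\operatorname{ppart}(n)}>\operatorname{ppart}(n),$$ where the gcd is taken over all integers $q$ with $2\le q\le k+1$, and $\operatorname{ppart}(n)$ is the largest exact prime-power component of $n$.
   Context: For a positive integer $n$ and a prime $p$, write $p^a\Vert n$ when $p^a\mid n$ and $p^{a+1}\nmid n$; such a $p^a$ is called an exact prime-power component of $n$. For an integer $n>1$, define $\operatorname{ppart}(n)=\max\{p^a:\ p \text{ prime},\ p^a\Vert n\}$. *)

(* Defs.v *)
From mathcomp Require Import all_boot.

Set Implicit Arguments.
Unset Strict Implicit.
Unset Printing Implicit Defensive.

(* For n > 0 and p prime, [logn p n] is the exponent a such that p ^ a || n.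
   Primes not dividing n only have the exact component p ^ 0 = 1, so for n > 1
   restricting to [primes n] does not change the maximum. *)
Definition ppart (n : nat) : nat := \max_(p <- primes n) p ^ logn p n.

(* Main.v *)
Require Import Defs.
From mathcomp Require Import all_boot.
From mathcomp Require Import zify.

(** The gcd is 1 when no prime p divides all the binomials 'C(q * k, k), so the
question can be studied one prime at a time. Write k + 1 = m * p ^ a with p not
dividing m. The claim is that p divides all of them exactly when m < p ^ a.
(Equality m = p ^ a is impossible for k + 1 > 1.) Since n / p ^ a decreases
when p ^ a grows, some prime satisfies m < p ^ a exactly when the prime of
the largest component does, which is the failure of n / ppart n > ppart n.

By Kummer's theorem ([dvdn_bin_carry]), p does not divide 'C(q * k, k) exactly
when k and (q - 1) * k add without carry in base p. The last a digits of k are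
all p - 1, so this forces q = 1 + t * p ^ a with 0 < t < m, and what remains is
that M = m - 1 and t * k add without carry, where k = m * p ^ a - 1.

If m < p ^ a, then t * k is -t modulo p ^ a, and M - t >= 0 shows that the sum
M + t * k carries out of the last a digits ([dvdn_all_bin]).

If m > p ^ a, a suitable t is built ([exists_bin_not_dvd]). M has more than a
digits, and its last digit is not p - 1 since p does not divide M + 1. Cut M
after the first digit d < p - 1 that follows its top a digits; the digits
below are made harmless by taking for t a multiple u * p ^ e. Let the part kept
have a + f digits: A (a digits), then f - 1 digits p - 1, then d. It is enough
to find u, not exceeding this part, such that the last a + f digits of u * k
are V, then f - 1 zeros, then a digit at most p - 1 - d, where V adds to A
without carry.
- For a > 0, k is -1 modulo p ^ a but not modulo p ^ (a + 1). With last digit 1,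
  u must be U - V * p ^ f where U is the inverse of k. The digit by digit choice
  of V in [nocarry_sub] makes this small enough, except when the top a digits of
  U are all p - 1; then only the low digits of U matter, and they are too large
  only if U is -1 modulo p ^ (a + f), that is, if p ^ (a + f) divides k + 1.
- For a = 0, A and V are absent. If p divides k, a power of p works. Otherwise
  one needs 0 < u <= M' with u * k modulo p ^ f at most p ^ f - 1 - M', where M'
  is the part kept. This is [exists_small_mod], which holds for every modulus P
  coprime to k and not dividing k + 1. *)

Set Implicit Arguments.
Unset Strict Implicit.
Unset Printing Implicit Defensive.

(** * Carries and Kummer's theorem *)

(** The sum of the truncations to j digits reaches p ^ j exactly when the
schoolbook addition of x and y carries out of position j.-1. *)
Definition nocarry (p x y : nat) : Prop :=
  forall j, x %% p ^ j + y %% p ^ j < p ^ j.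

Lemma logn_fact_widen p n N : prime p -> n <= N ->
  logn p n`! = \sum_(1 <= j < N.+1) n %/ p ^ j.
Proof.
move=> p_pr le_nN; rewrite logn_fact // [RHS](@big_cat_nat _ _ _ n.+1) //=.
rewrite [X in _ + X]big_nat_cond [X in _ + X]big1 ?addn0 // => j.
case/andP=> /andP[lt_nj _] _.
rewrite divn_small // (leq_trans lt_nj) // ltnW // ltn_expl //; exact: prime_gt1.
Qed.

(** Kummer's formula. By Legendre's formula the valuation is the sum over j of
(x + y) %/ p ^ j - x %/ p ^ j - y %/ p ^ j, which is the carry out of the last
j digits. *)
Lemma logn_bin p x y : prime p ->
  logn p 'C(x + y, x) =
    \sum_(1 <= j < (x + y).+1) (p ^ j <= x %% p ^ j + y %% p ^ j).
Proof.
move=> p_pr; have := congr1 (logn p) (bin_fact (leq_addr y x)).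
rewrite addKn !lognM ?muln_gt0 ?fact_gt0 ?bin_gt0 ?leq_addr //.
rewrite !(@logn_fact_widen _ _ (x + y)) ?leq_addr ?leq_addl //.
rewrite -big_split /= => def_log; apply/(@addIn _ _ _ (etrans def_log _)).
rewrite -big_split; apply: eq_bigr => j _ /=.
by rewrite divnD ?expn_gt0 ?prime_gt0 // addnC.
Qed.

Lemma dvdn_bin_carry p x y : prime p ->
  ~~ (p %| 'C(x + y, x)) <-> nocarry p x y.
Proof.
move=> p_pr; have p_gt1 := prime_gt1 p_pr.
have C_gt0 : 0 < 'C(x + y, x) by rewrite bin_gt0 leq_addr.
rewrite -{1}[p]expn1 pfactor_dvdn // -eqn0Ngt logn_bin // sum_nat_seq_eq0.
split=> [/allP no_carry j | no_carry].
  have [j_range | ] := boolP (j \in index_iota 1 (x + y).+1).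
    by have:= no_carry j j_range; rewrite /= eqb0 -ltnNge.
  case: j => [|j]; first by rewrite !modn1.
  rewrite mem_index_iota /= -leqNgt => lt_j.
  apply: leq_ltn_trans (leq_add (leq_mod _ _) (leq_mod _ _)) _.
  exact: ltn_trans lt_j (ltn_expl _ p_gt1).
by apply/allP=> j _ /=; rewrite eqb0 -ltnNge.
Qed.

(** * Addition without carry, digit by digit *)

Lemma nocarry0 p x : 0 < p -> nocarry p x 0.
Proof. by move=> p_gt0 j; rewrite mod0n addn0 ltn_mod expn_gt0 p_gt0. Qed.

Lemma nocarryC p x y : nocarry p x y -> nocarry p y x.
Proof. by move=> nc j; rewrite addnC. Qed.

Lemma nocarry_digit p x y : 1 < p -> x + y < p -> nocarry p x y.
Proof.
move=> p_gt1 lt_p [|j]; first by rewrite !modn1.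
apply: leq_ltn_trans (leq_add (leq_mod _ _) (leq_mod _ _)) (leq_trans lt_p _).
by rewrite -{1}[p]expn1 leq_exp2l.
Qed.

Lemma modn_block p f j x1 x0 : 1 < p -> x0 < p ^ f ->
  (x1 * p ^ f + x0) %% p ^ (f + j) = x1 %% p ^ j * p ^ f + x0.
Proof.
move=> p_gt1 lt_x0; have p_gt0 i : 0 < p ^ i by rewrite expn_gt0 ltnW.
rewrite {1}(divn_eq x1 (p ^ j)) mulnDl -addnA -mulnA -expnD [j + f]addnC modnMDl.
rewrite modn_small // expnD.
move: (ltn_pmod x1 (p_gt0 j)) lt_x0; move: (p ^ f) (p ^ j) (x1 %% _); nia.
Qed.

Lemma ltn_block b x1 x0 y1 : x1 < y1 -> x0 < b -> x1 * b + x0 < y1 * b.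
Proof.
move=> lt_xy lt_x0; apply: (@leq_trans (x1.+1 * b)).
  by rewrite mulSnr ltn_add2l.
by rewrite leq_mul2r lt_xy orbT.
Qed.

(** Addition can be done by blocks of f digits: without a carry in the low block,
the high blocks are added independently. *)
Lemma nocarry_block p f x1 x0 y1 y0 : 1 < p -> x0 < p ^ f -> y0 < p ^ f ->
    nocarry p x1 y1 -> nocarry p x0 y0 ->
  nocarry p (x1 * p ^ f + x0) (y1 * p ^ f + y0).
Proof.
move=> p_gt1 lt_x0 lt_y0 nc1 nc0 j; case: (leqP j f) => [le_jf | lt_fj].
  by rewrite -(subnK le_jf) expnD !mulnA !modnMDl.
rewrite -(subnKC (ltnW lt_fj)) !modn_block // expnD.
move: (nc1 (j - f)) (nc0 f); rewrite !(@modn_small _ (p ^ f)) //.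
move: (p ^ f) (p ^ (j - f)) (x1 %% _) (y1 %% _); nia.
Qed.

Lemma nocarry_mod p i x y : 1 < p -> x < p ^ i ->
  nocarry p x (y %% p ^ i) -> nocarry p x y.
Proof.
move=> p_gt1 lt_x nc; rewrite (divn_eq y (p ^ i)) -[x](add0n x) -(mul0n (p ^ i)).
apply: nocarry_block => //; first by rewrite ltn_mod expn_gt0 ltnW.
exact/nocarryC/nocarry0/ltnW.
Qed.

(** The digits of p ^ f - p + d are f.-1 digits p.-1, then d: only the last
position leaves room for y. *)
Lemma nocarry_last_digit p f d y : 1 < p -> 0 < f -> d + y < p ->
  nocarry p (p ^ f - p + d) y.
Proof.
case: f => // f p_gt1 _ lt_p.
have := @nocarry_block p 1 (p ^ f - 1) d 0 y p_gt1.
rewrite expn1 mul0n add0n mulnBl mul1n -expnSr; apply; [lia | lia | |].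
  exact/nocarry0/ltnW.
exact: nocarry_digit.
Qed.

(** The numbers that add to M without carry are those below the digitwise
complement of M. Taking for V the digits w - c where the digit w of U exceeds
the digit c of M, and 0 elsewhere, leaves U - V below M digit by digit, with
equality only if no digit of U is smaller; once a strict inequality has
occurred, the lower digits of V can be 0. In the case of equality one digit of
V can still be increased, unless all digits of U are p.-1. The last hypothesis says
that M has exactly a digits, which makes that increase possible. *)
Lemma nocarry_sub p a M U : 1 < p -> M < p ^ a -> U < p ^ a ->
    a = 0 \/ p ^ a <= M * p ->
  exists V, [/\ nocarry p M V, V < p ^ a, V <= U, U - V <= M
              & U - V < M \/ U = p ^ a - 1].
Proof.
move=> p_gt1; have p_gt0 := ltnW p_gt1.
elim: a M U => [|a IHa] M U lt_M lt_U M_ge.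
  move: lt_M lt_U; rewrite !expn0 !ltnS !leqn0 => /eqP-> /eqP->.
  by exists 0; split; [exact: nocarry0 | | | | right].
have {}M_ge : p ^ a.+1 <= M * p by case: M_ge.
rewrite expnS in lt_M lt_U M_ge *; set Q := p ^ a in lt_M lt_U M_ge *.
have Q_gt0 : 0 < Q by rewrite expn_gt0 p_gt0.
have def_M := divn_eq M p; have def_U := divn_eq U p.
move: (ltn_pmod M p_gt0) (ltn_pmod U p_gt0) def_M def_U.
move: (M %/ p) (M %% p) (U %/ p) (U %% p) => M1 c U1 w lt_c lt_w def_M def_U.
have [||| V [ncV lt_V le_V le_UV strict]] := IHa M1 U1.
- by rewrite -/Q; nia.
- by rewrite -/Q; nia.
- case: a @Q Q_gt0 lt_M lt_U M_ge {IHa} => [|b] Q Q_gt0 lt_M lt_U M_ge.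
    by left.
  right; rewrite expnS mulnC leq_pmul2r //; rewrite /Q expnS in M_ge; nia.
have nc v : c + v < p -> nocarry p M (V * p + v).
  move=> lt_p; have := @nocarry_block p 1 M1 c V v p_gt1.
  by rewrite expn1 -def_M; apply=> //; [lia | exact: nocarry_digit].
have bound v : v < p -> V * p + v < p * Q by rewrite -/Q in lt_V; nia.
have M_gt0 : 0 < M by nia.
rewrite -/Q in strict.
case: (ltnP (U1 - V) M1) strict => [lt_UV _ | ge_UV [//|U1_max]].
  by exists (V * p + 0); split;
    [apply: nc; lia | apply: bound; lia | nia | nia | left; nia].
(* From here on U1 - V = M1, so strictness is decided by the last digit. *)
have {le_UV ge_UV} eq_UV : U1 = V + M1 by lia.
case: (ltnP w c) => [lt_wc | le_cw].
  by exists (V * p + 0); split;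
    [apply: nc; lia | apply: bound; lia | nia | nia | left; nia].
case: (eqVneq w p.-1) => [w_max | w_not_max].
  by exists (V * p + (w - c)); split;
    [apply: nc; lia | apply: bound; lia | nia | nia | right; nia].
(* One more than w - c still fits below the complement p.-1 - c, and turns
   the equality into a strict inequality. *)
by exists (V * p + (w - c).+1); split;
  [apply: nc; lia | apply: bound; lia | nia | nia | left; nia].
Qed.

(** Reading M from the top, skip the first block M %/ p ^ l, then the digits p.-1
that follow it, and stop after the first digit d that is not p.-1. Such a
digit exists because the last one qualifies. *)
Lemma prefix_before_short_digit p M l : 0 < p -> ~~ (p %| M.+1) -> 0 < l ->
  exists f d, [/\ 0 < f <= l, d.+1 < p
    & M %/ p ^ (l - f) = M %/ p ^ l * p ^ f + (p ^ f - p + d)].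
Proof.
move=> p_gt0 ndv_M; case: l => // l _; elim: l => [|l IHl].
  exists 1, (M %% p); split=> //; last by rewrite !expn1 divn1 subnn add0n -divn_eq.
  (* The last digit of M is short, for otherwise p would divide M.+1. *)
  have := ltn_pmod M p_gt0; rewrite leq_eqVlt => /predU1P[full_d | //].
  by rewrite (divn_eq M p) -addnS full_d dvdn_addr ?dvdnn ?dvdn_mull in ndv_M.
have def_d : M %/ p ^ l.+1 = M %/ p ^ l.+2 * p + M %/ p ^ l.+1 %% p.
  by rewrite {1}(divn_eq (M %/ p ^ l.+1) p) -divnMA -expnSr.
have := ltn_pmod (M %/ p ^ l.+1) p_gt0; rewrite leq_eqVlt => /predU1P[full_d | ?].
  have [f [d [f_range lt_d def_M]]] := IHl.
  exists f.+1, d; split; [lia | by [] |].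
  rewrite subSS def_M {1}def_d.
  have p_le : p <= p ^ f by rewrite -{1}[p]expn1 leq_pexp2l; lia.
  rewrite (expnS p f); move: full_d; move: (p ^ f) p_le (M %/ p ^ l.+2) (_ %% _).
  move=> q p_le x r def_p.
  have le_ppq : p <= p * q by rewrite leq_pmulr // (leq_trans p_gt0).
  rewrite mulnDl -mulnA -addnA; congr (_ + _).
  by rewrite addnA addnBA // -mulSnr def_p.
exists 1, (M %/ p ^ l.+1 %% p); split=> //.
by rewrite subSS subn0 expn1 subnn add0n.
Qed.

(** * Small multiples in a residue class *)

(** Two numbers with a common additive inverse are congruent; this is how
congruences to negatives are handled without leaving nat. *)
Lemma eq_mod_of_dvdD d x y z : d %| x + z -> d %| y + z -> x = y %[mod d].
Proof.
by move=> /eqP xz /eqP yz; apply/eqP; rewrite -(eqn_modDr z) xz yz.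
Qed.

(** The multiples of j advance by steps j <= c, so the first one above c is at
most 2 * c and has not yet wrapped around P. *)
Lemma exists_large_mod P j c : 1 < j < P -> 0 < c -> 2 * c < P ->
  exists2 s, 0 < s <= c & c < (s * j) %% P.
Proof.
move=> /andP[j_gt1 lt_jP] c_gt0 lt_cP; case: (ltnP c j) => [lt_cj | le_jc].
  by exists 1; rewrite // mul1n modn_small.
have def_c := divn_eq c j; have c_mod := ltn_pmod c (ltnW j_gt1).
exists (c %/ j).+1; first by nia.
by rewrite modn_small; lia.
Qed.

(** If no u worked, multiplication by -k would send {1, ..., M} into itself
modulo P; by symmetry the inverse of -k would do the same for
{1, ..., P.-1 - M}. One of these two intervals is shorter than P / 2, where
[exists_large_mod] excludes this, since -k is not 1
modulo P. *)
Lemma exists_small_mod P k M : coprime P k -> ~~ (P %| k.+1) -> 0 < M ->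
    M.+1 < P ->
  exists2 u, 0 < u <= M & (u * k) %% P + M < P.
Proof.
move=> co_Pk ndv_k M_gt0 lt_MP; have P_gt0 : 0 < P by lia.
have k_mod := ltn_pmod k P_gt0.
case: (ltnP (2 * M) P) => [half_M | half_M].
  have k0 : 0 < k %% P.
    rewrite lt0n; apply: contraTneq co_Pk => k0.
    by rewrite -coprime_modr k0 /coprime gcdn0; lia.
  pose j := P - k %% P.
  have dv_kj : P %| k + j by rewrite /dvdn -modnDml subnKC ?modnn // ltnW.
  have j_gt1 : 1 < j < P.
    rewrite ltn_neqAle; apply/andP; split; last by lia.
    apply/andP; split; last by lia.
    by apply: contraNneq ndv_k => j1; rewrite -addn1 j1.
  have [s s_range lt_Ms] := exists_large_mod j_gt1 M_gt0 half_M.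
  exists s => //; set x := (s * j) %% P in lt_Ms.
  have lt_xP : x < P by rewrite ltn_pmod.
  suff -> : (s * k) %% P = P - x by lia.
  rewrite -[RHS](@modn_small _ P); last by lia.
  apply: (@eq_mod_of_dvdD _ _ _ (s * j)); first by rewrite -mulnDr dvdn_mull.
  by rewrite /dvdn -modnDmr subnK ?modnn // ltnW.
(* Otherwise P.-1 - M < P / 2, and the residue s of u * k is chosen first. *)
have [j lt_jP] := Bezoutl k P_gt0; rewrite (eqP co_Pk) => dv_jk.
have j_gt1 : 1 < j < P.
  rewrite lt_jP andbT; case: j {lt_jP} dv_jk => [|[|//]].
    by rewrite mul0n dvdn1; lia.
  by rewrite mul1n add1n (negPf ndv_k).
pose c := P.-1 - M.
have [||s s_range lt_cs] := @exists_large_mod P j c j_gt1; try by rewrite /c; lia.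
set x := (s * j) %% P in lt_cs; have lt_xP : x < P by rewrite ltn_pmod.
exists (P - x); first by lia.
suff -> : ((P - x) * k) %% P = s by lia.
rewrite -[RHS](@modn_small _ P); last by lia.
apply: (@eq_mod_of_dvdD _ _ _ (s * j * k)); last first.
  by rewrite -mulnA -{1}[s]muln1 -mulnDr dvdn_mull.
by rewrite -mulnDl dvdn_mulr // /dvdn -modnDmr subnK ?modnn // ltnW.
Qed.

(** * Multiples of k adding without carry *)

(** The case a = 0 of the main construction, where k itself is M and the leading
digits of k are f.-1 digits p.-1 followed by d. If p divides k, u = p ^ f.-1
makes the last f digits of u * k vanish. *)
Lemma exists_nocarry_multiple p f d k : prime p -> 0 < f -> d.+1 < p ->
    ~~ (p %| k.+1) -> p ^ f.-1 <= p ^ f - p + d ->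
  exists2 u, 0 < u <= p ^ f - p + d & nocarry p (p ^ f - p + d) (u * k).
Proof.
move=> p_pr f_gt0 lt_d ndv_k; have p_gt1 := prime_gt1 p_pr.
have p_gt0 := ltnW p_gt1; set M := _ + d => M_ge.
have p_le : p <= p ^ f by rewrite -{1}[p]expn1 leq_pexp2l.
have lt_M : M.+1 < p ^ f by lia.
have [/dvdnP[k' ->] | ndv_pk] := boolP (p %| k).
  exists (p ^ f.-1); first by rewrite M_ge expn_gt0 p_gt0.
  apply: (@nocarry_mod _ f) => //; first exact: ltnW.
  by rewrite mulnCA -expnSr prednK // modnMl; apply: nocarry0.
(* Below, u * k reduced modulo p ^ f is at most p.-1 - d: a single digit. *)
have co_pk : coprime (p ^ f) k by rewrite coprime_pexpl // prime_coprime.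
have [|||u u_range lt_uM] := @exists_small_mod (p ^ f) k M co_pk.
- by apply: contra ndv_k; apply: dvdn_trans; rewrite -{1}[p]expn1 dvdn_exp2l.
- by rewrite (leq_trans _ M_ge) // expn_gt0 p_gt0.
- by [].
exists u => //; apply: (@nocarry_mod _ f) => //; first exact: ltnW.
by apply: nocarry_last_digit => //; lia.
Qed.

(** The case a > 0. The leading digits of M are those of A, then f.-1 digits p.-1,
then d. The sought residue of u * k modulo p ^ (a + f) is V * p ^ f + 1 with V
adding to A without carry, and since k = -1 modulo p ^ a the corresponding u
is obtained from the inverse U of k by subtracting V from its top a digits.
[nocarry_sub] chooses V to make u small. *)
Lemma exists_nocarry_multiple_high p a f d A m k : prime p -> 0 < a -> 0 < f ->
    d.+1 < p -> ~~ (p %| m) -> k.+1 = m * p ^ a -> p ^ a <= A * p -> A < p ^ a ->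
  let M := A * p ^ f + (p ^ f - p + d) in
  exists2 u, 0 < u <= M & nocarry p M (u * k).
Proof.
move=> p_pr a_gt0 f_gt0 lt_d ndv_m def_k A_ge lt_A; have p_gt1 := prime_gt1 p_pr.
have p_gt0 := ltnW p_gt1; set Q := _ + d => M.
have p_le : p <= p ^ f by rewrite -{1}[p]expn1 leq_pexp2l.
have a_gt1 : 1 < p ^ a by rewrite -{1}(expn0 p) ltn_exp2l.
have lt_Q : Q < p ^ f by lia.
have P_gt1 : 1 < p ^ (a + f).
  by rewrite -{1}(expn0 p) ltn_exp2l // addn_gt0 a_gt0.
have lt_M : M < p ^ (a + f).
  by rewrite expnD ltn_block.
have co_pk : coprime (p ^ (a + f)) k.
  rewrite coprime_pexpl ?addn_gt0 ?a_gt0 // prime_coprime //.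
  apply/negP=> dv_k; have : p %| k.+1.
    by rewrite def_k dvdn_mull // -{1}[p]expn1 dvdn_exp2l.
  by rewrite -addn1 dvdn_addr // dvdn1; lia.
have [j lt_j] := Bezoutl k (ltnW P_gt1); rewrite (eqP co_pk) => dv_jk.
have j_gt0 : 0 < j.
  by case: j dv_jk {lt_j} => //; rewrite mul0n addn0 dvdn1; lia.
(* U is the inverse of k modulo p ^ (a + f); u is U with V subtracted from its
   top a digits. *)
pose U := p ^ (a + f) - j.
have Uk1 : U * k = 1 %[mod p ^ (a + f)].
  apply: (@eq_mod_of_dvdD _ _ _ (j * k)) => //.
  by rewrite -mulnDl subnK ?dvdn_mulr // ltnW.
have lt_U : U < p ^ a * p ^ f by rewrite -expnD ltn_subrL j_gt0 ltnW.
have pf_gt0 : 0 < p ^ f by rewrite expn_gt0 p_gt0.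
have lt_U1 : U %/ p ^ f < p ^ a by rewrite ltn_divLR.
have [V [ncV lt_V le_V le_UV strict]] :=
  nocarry_sub p_gt1 lt_A lt_U1 (or_intror A_ge).
have dv_pk : p %| k.+1 by rewrite def_k dvdn_mull // -{1}[p]expn1 dvdn_exp2l.
(* When the top a digits of U are all p.-1, a last block above Q would force
   j < p, hence j = 1, and then p ^ (a + f) would divide k.+1. *)
have U0_le : U %/ p ^ f = p ^ a - 1 -> U %% p ^ f <= Q.
  move=> U1_max; rewrite leqNgt; apply/negP=> lt_QU0.
  have def_j : j = p ^ f - U %% p ^ f.
    have def_P : p ^ (a + f) = (p ^ a - 1) * p ^ f + p ^ f.
      by rewrite expnD -mulSnr subn1 prednK // ltnW.
    have : U + j = p ^ (a + f) by rewrite subnK // ltnW.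
    rewrite def_P {1}(divn_eq U (p ^ f)) U1_max -addnA => /addnI def_pf.
    by rewrite -[X in X - _]def_pf addKn.
  have lt_jp : j < p.
    rewrite def_j; move: lt_QU0 p_le p_gt0; rewrite /Q.
    move: (p ^ f) (U %% _); clear; lia.
  have : j = 1 %[mod p].
    apply: (@eq_mod_of_dvdD _ _ _ (j * k)); first by rewrite -mulnS dvdn_mull.
    by apply: dvdn_trans dv_jk; rewrite -{1}[p]expn1 dvdn_exp2l // addn_gt0 a_gt0.
  rewrite !modn_small // => j1; move: dv_jk.
  rewrite j1 mul1n add1n def_k addnC expnD dvdn_pmul2r ?(ltnW a_gt1) // => dv_m.
  move/negP: ndv_m; apply; apply: dvdn_trans dv_m.
  by rewrite -{1}[p]expn1 dvdn_exp2l.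
(* As k = -1 modulo p ^ a, subtracting V * p ^ f from U adds it to U * k. *)
pose u := (U %/ p ^ f - V) * p ^ f + U %% p ^ f.
have def_U : U = u + V * p ^ f.
  by rewrite addnAC -mulnDl subnK // -divn_eq.
have uk_mod : u * k = V * p ^ f + 1 %[mod p ^ (a + f)].
  apply/eqP; rewrite -(eqn_modDr (V * p ^ f * k)) -mulnDl -def_U Uk1.
  by rewrite addnAC -mulnS def_k mulnACA -expnD [f + a]addnC modnMDl.
have lt_y : V * p ^ f + 1 < p ^ (a + f).
  by rewrite expnD ltn_block // (leq_trans p_gt1).
have u_gt0 : 0 < u.
  rewrite lt0n; apply/eqP=> u0; move: uk_mod.
  by rewrite u0 mul0n mod0n modn_small // addn1.
exists u; first rewrite u_gt0 /=.
  case: strict => [lt_UV | U1_max].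
    by apply: leq_trans (leq_addr _ _); rewrite ltnW // ltn_block // ltn_pmod.
  by rewrite leq_add ?U0_le // leq_mul2r le_UV orbT.
apply: (@nocarry_mod _ (a + f)) => //; rewrite uk_mod modn_small //.
apply: nocarry_block => //; first exact: leq_trans p_gt1 p_le.
by apply: nocarry_last_digit; rewrite // addn1.
Qed.

(** * Which primes divide all the binomials *)

(** Without a carry in k + (q - 1) * k the last a digits force q - 1 = t * p ^ a
with t < m; then the next a digits must carry, because (q - 1) * k is
-t * p ^ a modulo p ^ (a + a) while k = m * p ^ a - 1 is at least t * p ^ a. *)
Lemma dvdn_all_bin p a m k : prime p -> 0 < a -> m < p ^ a -> k.+1 = m * p ^ a ->
  forall q, 1 < q -> q <= k.+1 -> p %| 'C(q * k, k).
Proof.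
move=> p_pr a_gt0 lt_m def_k [//|q]; rewrite !ltnS => q_gt0 le_qk.
have p_gt1 := prime_gt1 p_pr.
apply: contraT; rewrite mulSn => /(dvdn_bin_carry _ _ p_pr) nc.
have P_gt0 : 0 < p ^ a by rewrite expn_gt0 ltnW.
have m_gt0 : 0 < m by nia.
(* The last a digits of k are p.-1, so q * k must end with a zeros. *)
have k_mod : k %% p ^ a = p ^ a - 1.
  have -> : k = m.-1 * p ^ a + (p ^ a - 1) by nia.
  by rewrite modnMDl modn_small //; lia.
have co_pk : coprime (p ^ a) k.
  have := coprimenS k; rewrite def_k coprimeMr => /andP[_].
  by rewrite coprime_sym.
have dv_q : p ^ a %| q.
  rewrite -(Gauss_dvdl _ co_pk); have := nc a; rewrite k_mod /dvdn; lia.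
case/dvdnP: dv_q => t def_q.
have lt_tm : t < m by nia.
(* Modulo p ^ (a + a), z is -q, whose complement q is at most k. *)
have := nc (a + a); set z := (q * k) %% _.
have k_lt : k < p ^ (a + a) by rewrite expnD; nia.
rewrite modn_small //.
have : p ^ (a + a) %| z + q.
  by rewrite /dvdn modnDml -mulnSr def_k def_q mulnACA -expnD modnMl.
have zq_gt0 : 0 < z + q by lia.
move/(dvdn_leq zq_gt0); nia.
Qed.

(** Take q = 1 + t * p ^ a with M = m - 1. The last a digits of k are p.-1 and face
zeros, so what is needed is t <= M such that M and t * k add without carry.
If t is a multiple of p ^ e, only the digits of M from position e on matter;
e is chosen to cut M after its first short digit beyond the top a ones. *)
Lemma exists_bin_not_dvd p a m k : prime p -> ~~ (p %| m) -> p ^ a < m ->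
    k.+1 = m * p ^ a ->
  exists2 q, 1 < q <= k.+1 & ~~ (p %| 'C(q * k, k)).
Proof.
case: m => // M p_pr ndv_M; rewrite ltnS => M_ge def_k.
have p_gt1 := prime_gt1 p_pr.
have p_gt0 := ltnW p_gt1; have pX_gt0 i : 0 < p ^ i by rewrite expn_gt0 p_gt0.
have M_gt0 : 0 < M by apply: leq_trans M_ge.
have le_log := trunc_logP p_gt1 M_gt0; have lt_log := trunc_log_ltn M p_gt1.
move: (trunc_log p M) => h in le_log lt_log.
have le_ah : a <= h by rewrite -ltnS -(ltn_exp2l _ _ p_gt1) (leq_ltn_trans M_ge).
have l_gt0 : 0 < h.+1 - a by rewrite subn_gt0.
have [f [d [/andP[f_gt0 le_f] lt_d]]] :=
  prefix_before_short_digit p_gt0 ndv_M l_gt0.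
set e := h.+1 - a - f; set A := M %/ p ^ (h.+1 - a) => def_M.
(* Multiplying u by p ^ e shifts its digits past the part of M left out. *)
suff [u /andP[u_gt0 le_u] nc_u] :
    exists2 u, 0 < u <= M %/ p ^ e & nocarry p (M %/ p ^ e) (u * k).
  pose t := u * p ^ e.
  have t_gt0 : 0 < t by rewrite muln_gt0 u_gt0 pX_gt0.
  have le_t : t <= M by rewrite /t -leq_divRL.
  have nc_t : nocarry p M (t * k).
    rewrite /t mulnAC -[u * k * _]addn0 {1}(divn_eq M (p ^ e)).
    by apply: nocarry_block => //; [rewrite ltn_mod | exact: nocarry0].
  exists (t * p ^ a).+1.
    rewrite ltnS muln_gt0 t_gt0 pX_gt0 def_k mulSnr -addn1.
    by rewrite leq_add // leq_mul2r le_t orbT.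
  rewrite mulSn; apply/dvdn_bin_carry => //.
  have {1}-> : k = M * p ^ a + (p ^ a - 1).
    by rewrite addnBA // -mulSnr -def_k subn1.
  rewrite mulnAC -[t * k * _]addn0.
  by apply: nocarry_block => //; [rewrite subn1 prednK | exact: nocarry0].
rewrite def_M; case: (posnP a) => [a0 | a_gt0].
  have A0 : A = 0 by rewrite /A a0 subn0 divn_small.
  rewrite A0 mul0n add0n in def_M *.
  apply: exists_nocarry_multiple => //; first by rewrite def_k a0 expn0 muln1.
  rewrite -def_M leq_divRL // -expnD; suff -> : f.-1 + e = h by [].
  rewrite /e; lia.
apply: (exists_nocarry_multiple_high p_pr a_gt0 f_gt0 lt_d ndv_M def_k).
  rewrite -(prednK a_gt0) expnSr leq_mul2r leq_divRL // -expnD.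
  by have -> : a.-1 + (h.+1 - a) = h; [lia | rewrite le_log orbT].
by rewrite ltn_divLR // -expnD subnKC // ltnW.
Qed.

(** * The gcd and the largest prime-power component *)

Lemma bigmax_attained (I : eqType) (r : seq I) (F : I -> nat) i0 : i0 \in r ->
  exists2 i, i \in r & \max_(j <- r) F j = F i.
Proof.
elim: r i0 => // x r IHr i0 _; rewrite big_cons.
case: r IHr => [|y r] IHr; first by exists x; rewrite ?big_nil ?maxn0 ?mem_head.
have [i i_r ->] := IHr y (mem_head y r).
case: (leqP (F x) (F i)) => _; last by exists x; rewrite ?mem_head.
by exists i; rewrite // inE i_r orbT.
Qed.

(* [ppart n] divides n, so the quotient [n %/ ppart n] is exact. *)
Theorem theorem1p1 (k n : nat) (hk : 2 <= k) (hn : n = k + 1) :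
  \big[gcdn/0]_(2 <= q < k.+2) 'C(q * k, k) = 1 <->
  n %/ ppart n > ppart n.
Proof.
rewrite addn1 in hn; have n_gt0 : 0 < n by rewrite hn.
have dvd_gcdP d : reflect (forall q, 1 < q <= k.+1 -> d %| 'C(q * k, k))
    (d %| \big[gcdn/0]_(2 <= q < k.+2) 'C(q * k, k)).
  rewrite big_geq_mkord; apply: (iffP (dvdn_biggcdP _ _ _)) => dv q.
    by case/andP=> q_gt1 lt_q; apply: (dv (Ordinal (lt_q : q < k.+2))).
  by move=> q_gt1; apply: dv; rewrite -[q <= _]ltnS ltn_ord andbT.
set G := \big[gcdn/0]_(2 <= q < k.+2) _ in dvd_gcdP *.
split=> [G1 | lt_ppart].
  have pdiv_n : pdiv n \in primes n.
    by rewrite mem_primes pdiv_prime ?pdiv_dvd ?n_gt0 // hn; lia.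
  have [p p_n def_ppart] := bigmax_attained (fun p => p ^ logn p n) pdiv_n.
  rewrite -/(ppart n) in def_ppart; rewrite def_ppart ltnNge; apply/negP=> le_m.
  move: (p_n); rewrite mem_primes => /and3P[p_pr _ _].
  have p_gt1 := prime_gt1 p_pr.
  have [m co_pm def_n] := pfactor_coprime p_pr n_gt0.
  have a_gt0 : 0 < logn p n by rewrite logn_gt0.
  move: (logn p n) => a in a_gt0 def_n le_m.
  rewrite def_n mulnK ?expn_gt0 ?prime_gt0 // leq_eqVlt in le_m.
  case/predU1P: le_m => [def_m | lt_m].
    by rewrite def_m coprime_pexpr // /coprime gcdnn in co_pm; lia.
  have : p %| G.
    apply/dvd_gcdP=> q /andP[q_gt1 le_q].
    by apply: (dvdn_all_bin p_pr a_gt0 lt_m _ q_gt1 le_q); rewrite -hn.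
  by rewrite G1 dvdn1; lia.
have G_gt0 : 0 < G.
  have dv_C : G %| 'C(2 * k, k) by move/dvd_gcdP: (dvdnn G); apply; lia.
  by apply: dvdn_gt0 dv_C; rewrite bin_gt0 leq_pmull.
apply/eqP; rewrite eqn_leq G_gt0 andbT leqNgt; apply/negP=> G_gt1.
have p_pr := pdiv_prime G_gt1; set p := pdiv G in p_pr.
have [m co_pm def_n] := pfactor_coprime p_pr n_gt0.
have le_ppart : p ^ logn p n <= ppart n.
  have [p_n | ] := boolP (p \in primes n).
    by rewrite /ppart (@leq_bigmax_seq _ _ _ (fun p => p ^ logn p n)).
  rewrite -logn_gt0 -eqn0Ngt => /eqP->; rewrite expn0 lt0n.
  by apply: contraTneq lt_ppart => ->; rewrite divn0.
have [|||q q_range] := @exists_bin_not_dvd p (logn p n) m k p_pr.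
- by rewrite -prime_coprime.
- apply: (leq_ltn_trans le_ppart (leq_trans lt_ppart _)).
  have pX_gt0 : 0 < p ^ logn p n by rewrite expn_gt0 prime_gt0.
  have <- : n %/ p ^ logn p n = m by rewrite {1}def_n mulnK.
  exact: leq_div2l.
- by rewrite -hn.
by move/dvd_gcdP: (pdiv_dvd G) => /(_ q q_range) ->.
Qed.
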